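(* Consider mixture models with $G$ and $G-1$ components for data $Y=(Y_1,\dots,Y_n)$, with marginal likelihoods $Z(G)$ and $Z(G-1)$. Suppose the proportions have a Dirichlet$(e_1,\dots,e_G)$ prior, $e_g>0$ (and Dirichlet$(e_1,\dots,e_{G-1})$ in the $(G-1)$-component model), the component parameters $\xi_1,\dots,\xi_G$ are a priori independent with a prior that does not depend on the total number of components, and the prior of the $G$-component model is invariant under relabelling of components. Let $\theta^{(1)},\dots,\theta^{(T)}$ be posterior draws in the $G$-component model and define $$\hat z^{(t)}_{i,g}=\frac{\tau_g^{(t)}f(Y_i;\xi_g^{(t)})}{\sum_{\tilde g=1}^G\tau^{(t)}_{\tilde g}f(Y_i;\xi^{(t)}_{\tilde g})},\qquad \hat p_0(G)=\frac1G\sum_{g=1}^G\frac1T\sum_{t=1}^T\prod_{i=1}^n\bigl(1-\hat z^{(t)}_{i,g}\bigr).$$ If $\hat Z(G-1)$ is a consistent estimator of $Z(G-1)$ and $\hat p_0(G)$ is a consistent estimator of its posterior mean $p_0(G)=\mathrm E[\frac1G\sum_g\prod_i(1-z_{i,g})\mid Y]$, assumed positive, then $$\hat Z(G)=\frac{\Gamma\bigl(\sum_{g=1}^Ge_g\bigr)\Gamma\bigl(n+\sum_{g=1}^{G-1}e_g\bigr)}{\Gamma\bigl(n+\sum_{g=1}^Ge_g\bigr)\Gamma\bigl(\sum_{g=1}^{G-1}e_g\bigr)}\cdot\hat Z(G-1)\cdot\frac{1}{\hat p_0(G)}$$ is a consistent estimator of $Z(G)$. Moreover $p_0(G)$ equals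 the posterior probability that component $G$ is empty (i.e. that no observation is allocated to it).
   Context: Mixture model: $Y_i$ i.i.d. with density $\sum_{g=1}^G\tau_g f(\cdot;\xi_g)$; equivalently, latent allocations $C_i\mid\tau\sim\mathrm{Multinom}_G(1,\tau)$ i.i.d. and $Y_i\mid\xi,C_{i,g}=1\sim f(\cdot;\xi_g)$. $z_{i,g}$ denotes the quantity $\hat z_{i,g}$ evaluated at a generic parameter $\theta$ (the conditional probability that $C_{i,g}=1$ given $Y,\theta$). Consistency is as the simulation size $T\to\infty$. *)

(* Defs.v *)
From HB Require Import structures.
From mathcomp Require Import all_boot all_order all_algebra all_fingroup.
From mathcomp Require Import all_classical all_reals all_analysis.
From mathcomp Require Import measurable_realfun.

Set Implicit Arguments.
Unset Strict Implicit.
Unset Printing Implicit Defensive.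

Import Order.TTheory GRing.Theory Num.Theory.
Import numFieldNormedType.Exports.

Local Open Scope classical_set_scope.
Local Open Scope ring_scope.

Section Defs.
Context {R : realType}.

Definition Gamma (x : R) : R :=
  fine (\int[@lebesgue_measure R]_(t in [set t : R | (0 <= t)%R])
          ((t `^ (x - 1)) * expR (- t))%R%:E)%E.

Definition upd {T : Type} (x : nat -> T) (k : nat) (u : T) : nat -> T :=
  fun j => if j == k then u else x j.

Fixpoint iint {d} {T : measurableType d} (mu : nat -> set T -> \bar R)
  (k : nat) (h : (nat -> T) -> \bar R) : (nat -> T) -> \bar R :=
  match k with
  | 0 => h
  | k'.+1 => fun x => (\int[mu k']_u iint mu k' h (upd x k' u))%E
  end.

Section Model.
Context {d : measure_display} {Xi : measurableType d}.

(** A parameter of the G-component model is theta = (tau, xi):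
    tau g = weight of component g, xi g = parameter of component g,
    for g < G (coordinates >= G are irrelevant).
    Components are indexed 0..G-1; "component G" of the paper is index G-1. *)
Definition param := ((nat -> R) * (nat -> Xi))%type.

Definition tau_of (G : nat) (t : nat -> R) : nat -> R :=
  fun g => if (g < G.-1)%N then t g
           else if g == G.-1 then 1 - \sum_(j < G.-1) t j else 0.

Definition in_simplex (G : nat) (t : nat -> R) : bool :=
  [forall j : 'I_G.-1, 0 < t j] && (\sum_(j < G.-1) t j < 1).

(** Dirichlet(e_0,...,e_{G-1}) density w.r.t. Lebesgue measure on the
    free coordinates t_0..t_{G-2}. *)
Definition dir_dens (e : nat -> R) (G : nat) (t : nat -> R) : R :=
  (in_simplex G t)%:R *
  (Gamma (\sum_(g < G) e g) / \prod_(g < G) Gamma (e g)) *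
  \prod_(g < G) (tau_of G t g) `^ (e g - 1).

(** Prior expectation in the G-component model:
    tau ~ Dirichlet(e_0..e_{G-1}), independent of xi_0,...,xi_{G-1},
    which are independent with xi_g ~ pi g (a prior not depending on G). *)
Definition prior_expect (e : nat -> R) (pi : nat -> probability Xi R)
  (G : nat) (h : param -> \bar R) : \bar R :=
  iint (fun _ => @lebesgue_measure R) G.-1
    (fun t => ((dir_dens e G t)%:E *
               iint (fun g => (pi g : set Xi -> \bar R)) G
                 (fun x => h (tau_of G t, x)) (fun _ => point))%E)
    (fun _ => 0).

Section Data.
Context {Y : Type} {n : nat} (y : 'I_n -> Y) (f : Y -> Xi -> R).

Definition lik (G : nat) (th : param) : R :=
  \prod_(i < n) \sum_(g < G) th.1 g * f (y i) (th.2 g).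

Definition marg_lik (e : nat -> R) (pi : nat -> probability Xi R) (G : nat)
  : \bar R := prior_expect e pi G (fun th => (lik G th)%:E).

Definition post_expect e pi G (h : param -> R) : R :=
  fine (prior_expect e pi G (fun th => (h th * lik G th)%:E))
  / fine (marg_lik e pi G).

(** z_{i,g}(theta): conditional probability that C_{i,g} = 1 given Y, theta. *)
Definition zprob (G : nat) (th : param) (i : 'I_n) (g : nat) : R :=
  th.1 g * f (y i) (th.2 g) / \sum_(g' < G) th.1 g' * f (y i) (th.2 g').

Definition empty_stat (G : nat) (th : param) : R :=
  G%:R^-1 * \sum_(g < G) \prod_(i < n) (1 - zprob G th i g).

Definition p0 e pi G : R := post_expect e pi G (empty_stat G).

(** Posterior probability that component g receives no observation, in the
    model with latent allocations C (summing the joint posterior of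
    (C, theta) over allocations c avoiding g). *)
Definition post_prob_empty e pi G (g : nat) : R :=
  fine (\sum_(c : {ffun 'I_n -> 'I_G} | [forall i, val (c i) != g])
          prior_expect e pi G
            (fun th => (\prod_(i < n) (th.1 (c i) * f (y i) (th.2 (c i))))%:E))%E
  / fine (marg_lik e pi G).

Definition p0hat (G : nat) (draws : nat -> param) (T : nat) : R :=
  G%:R^-1 * \sum_(g < G) (T%:R^-1 *
     \sum_(t < T) \prod_(i < n) (1 - zprob G (draws t) i g)).

End Data.

Definition permn (G : nat) (s : {perm 'I_G}) (g : nat) : nat :=
  match @insub nat (fun k => (k < G)%N) 'I_G g with
  | Some i => val (s i)
  | None => g
  end.

Definition relabel (G : nat) (s : {perm 'I_G}) (th : param) : param :=
  (fun g => th.1 (permn s g), fun g => th.2 (permn s g)).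

Definition cyl (G : nat) : set (set param) :=
  [set A | exists (a : nat -> set R) (b : nat -> set Xi),
     (forall g, measurable (a g) /\ measurable (b g)) /\
     A = [set th | forall g, (g < G)%N -> a g (th.1 g) /\ b g (th.2 g)]].

Definition ParG (G : nat) := g_sigma_algebraType (cyl G).

Definition relabel_invariant e pi (G : nat) : Prop :=
  forall (s : {perm 'I_G}) (h : ParG G -> \bar R),
    measurable_fun setT h -> (forall th, (0 <= h th)%E) ->
    prior_expect e pi G (fun th => h (relabel s th)) = prior_expect e pi G h.

End Model.

Definition consistent {d} {Om : measurableType d} (P : probability Om R)
  (X : nat -> Om -> R) (c : R) : Prop :=
  (forall T, measurable_fun setT (X T)) /\
  forall eps : R, 0 < eps ->
    (fun T => P [set w | eps <= `|X T w - c|]) @ \oo --> 0%E.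

End Defs.

(* Main.v *)
(** Write L_g for the likelihood with component g deleted,
    prod_i sum_(j <> g) tau_j f(y_i; xi_j).  Multiplying 1 - z_(i,g) by the
    mixture density of y_i removes its g-th term, so
    p0(G) * Z(G) = E[1/G sum_g L_g], which equals E[L_(G-1)] because the prior
    is exchangeable.  Expanding L_(G-1) over the allocations of the observations
    to the components 0, ..., G-2 separates weights and component parameters:
    each allocation contributes a Dirichlet moment times an integral over the
    xi_g.  With no observation in component G-1, passing from G-1 to G
    components leaves the latter integral unchanged and multiplies every
    Dirichlet moment by the same quotient k of Gamma values, so
    p0(G) * Z(G) = k * Z(G-1), and the estimator is a continuous function of two
    consistent ones.

    All integrands are finite sums of functions that are explicit under every
    partial iterated integral (products in the xi_g, Dirichlet kernels in the
    weights), so the iterated integrals of the prior need no Fubini theorem. *)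
Require Import Defs.
From HB Require Import structures.
From mathcomp Require Import all_boot all_order all_algebra all_fingroup.
From mathcomp Require Import all_classical all_reals all_analysis.
From mathcomp Require Import measurable_realfun.
From mathcomp Require Import ring lra.

Import Order.TTheory GRing.Theory Num.Theory.
Import numFieldNormedType.Exports.

Set Implicit Arguments.
Unset Strict Implicit.

Local Open Scope classical_set_scope.
Local Open Scope ring_scope.

(** * Gamma and Beta integrals *)

Section lebesgue_affine.
Context (R : realType).
Notation mu := (@lebesgue_measure R).

(** The pushforward of Lebesgue measure under [u |-> s * u + c], rescaled by [s], agrees with
    Lebesgue measure on half-open intervals, hence on all measurable sets. *)
Lemma ge0_integral_affine (s c : R) (h : R -> \bar R) : 0 < s ->
  measurable_fun setT h -> (forall u, (0 <= h u)%E) ->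
  (\int[mu]_u h u = s%:E * \int[mu]_u h (s * u + c)%R)%E.
Proof.
move=> s0 mh h0.
pose phi (u : measurableTypeR R) : measurableTypeR R := s * u + c.
have mphi : measurable_fun setT phi.
  by apply: measurable_funD => //; exact: measurable_funM.
(* the open measurability argument of [pushforward] makes [nu] a function of it *)
pose nu := mscale (NngNum (ltW s0)) (pushforward mu phi).
transitivity (\int[nu mphi]_u h u)%E; last first.
  rewrite ge0_integral_mscale//=.
  by congr (_ * _)%E; rewrite ge0_integral_pushforward// ?preimage_setT.
apply: eq_measure_integral => A mA _; apply: lebesgue_measure_unique => //.
move=> _ [[a b] _ <-]/=.
rewrite /mscale/= /pushforward.
have -> : phi @^-1` `]a, b] = `](a - c) / s, (b - c) / s]%classic.
  apply/seteqP; split=> u/=; rewrite !in_itv/= /phi;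
    by rewrite ltr_pdivrMr// ler_pdivlMr// mulrC ltrBlDr lerBrDr.
rewrite !lebesgue_measure_itv/= !lte_fin ltr_pM2r ?invr_gt0// ltrD2r.
case: ifPn => _; last by rewrite mule0.
by rewrite -!EFinB -EFinM; congr EFin; field; lra.
Qed.

End lebesgue_affine.

Section gamma_kernel.
Context (R : realType).
Notation mu := (@lebesgue_measure R).
Implicit Types a t : R.

(** The indicator extends Euler's integrand by zero, so that integrals run over the whole line and
    affine substitutions leave the domain alone. *)
Definition gamma_kernel a (t : R) : R :=
  (0 < t)%R%:R * (t `^ (a - 1) * expR (- t)).

Lemma gamma_kernel_ge0 a t : 0 <= gamma_kernel a t.
Proof. by rewrite mulr_ge0// mulr_ge0// ?powR_ge0 ?expR_ge0. Qed.

Lemma measurable_pos_indic : measurable_fun setT (fun t : R => (0 < t)%R%:R : R).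
Proof.
rewrite (_ : (fun _ => _) = \1_(`]0, +oo[%classic : set R)).
  exact: measurable_indic.
by apply/funext => t; rewrite indicE mem_setE in_itv/= andbT.
Qed.

Lemma measurable_gamma_kernel a : measurable_fun setT (gamma_kernel a).
Proof.
apply: measurable_funM; first exact: measurable_pos_indic.
apply: measurable_funM; first exact: measurable_powR.
by apply: measurableT_comp => //; exact: measurable_funN.
Qed.

Lemma Gamma_kernelE a : Gamma a = fine (\int[mu]_t (gamma_kernel a t)%:E).
Proof.
rewrite /Gamma; congr fine.
have -> : [set t : R | 0 <= t] = `[0, +oo[%classic.
  by apply/seteqP; split => t /=; rewrite in_itv/= andbT.
rewrite -integral_itv_obnd_cbnd; last first.
  apply/measurable_EFinP; apply: measurable_funTS.
  apply: measurable_funM; first exact: measurable_powR.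
  by apply: measurableT_comp => //; exact: measurable_funN.
rewrite integral_mkcond; apply: eq_integral => t _.
rewrite patchE mem_setE in_itv/= andbT /gamma_kernel.
by case: ifPn; rewrite ?mul1r ?mul0r.
Qed.

End gamma_kernel.

Section Gamma_integral.
Context (R : realType).
Notation mu := (@lebesgue_measure R).
Implicit Types a : R.

Lemma integral_powR01_lty a : 0 < a ->
  (\int[mu]_(t in `]0%R, 1%R]) (t `^ (a - 1))%:E < +oo)%E.
Proof.
(* With [n.+2] the left end stays strictly below 1, as the fundamental theorem of calculus
   requires. *)
move=> a0; pose E n : set R := `[n.+2%:R^-1, 1%R]%classic.
have E0 n x : E n x -> 0 < x.
  by rewrite /E/= in_itv/= => /andP[+ _]; apply: lt_le_trans.
have ndE : nondecreasing_seq E.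
  move=> m n mn; apply/subsetPset => x; rewrite /E/= !in_itv/= => /andP[h ->].
  by rewrite andbT (le_trans _ h)// lef_pV2 ?posrE// ler_nat.
have -> : `]0%R, 1%R]%classic = \bigcup_n E n.
  apply/seteqP; split=> x; last first.
    move=> [n _ Enx]; move: (Enx); rewrite /E/= !in_itv/= (E0 n x)//=.
    by case/andP.
  rewrite /= in_itv/= => /andP[x0 x1]; exists (Num.truncn x^-1) => //.
  rewrite /E/= in_itv/= x1 andbT -[leRHS]invrK lef_pV2 ?posrE ?invr_gt0//.
  by rewrite (le_trans (ltW (truncnS_gt _)))// ler_nat.
have mf n : measurable_fun (E n) (fun t : R => (t `^ (a - 1))%:E).
  apply: measurable_funTS.
  by apply/measurable_EFinP; exact: measurable_powR.
have cvgE : (\int[mu]_(t in E n) (t `^ (a - 1))%:E)%E @[n --> \oo] -->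
    (\int[mu]_(t in \bigcup_n E n) (t `^ (a - 1))%:E)%E.
  apply: ge0_nondecreasing_set_cvg_integral => // [n|n x _].
    exact: measurable_itv.
  by rewrite lee_fin powR_ge0.
apply: (@le_lt_trans _ _ a^-1%:E); last exact: ltry.
rewrite -(cvg_lim _ cvgE)//; apply: lime_le; first by apply/cvg_ex; eexists; exact: cvgE.
apply: nearW => n.
have c0 : 0 < n.+2%:R^-1 :> R by [].
have dF v x : 0 < x -> derivable (fun t : R => a^-1 * t `^ v) x 1.
  move=> x0; apply: derivableM => //; apply: derivable_powR.
  by rewrite in_itv/= andbT.
have cF v x : 0 < x -> {for x, continuous (fun t : R => a^-1 * t `^ v)}.
  by move=> x0; apply/differentiable_continuous/derivable1_diffP; exact: dF.
have c1 : n.+2%:R^-1 < 1 :> R by rewrite invf_lt1// ltr1n.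
rewrite (@continuous_FTC2 _ _ (fun t => a^-1 * t `^ a))//.
- rewrite powR1 mulr1 -EFinB lee_fin gerBl mulr_ge0 ?powR_ge0//.
  by rewrite invr_ge0 ltW.
- apply: continuous_in_subspaceT => x; rewrite inE => Enx.
  apply/differentiable_continuous/derivable1_diffP/derivable_powR.
  by rewrite in_itv/= andbT (E0 n).
- split.
  + by move=> x; rewrite in_itv/= => /andP[h _]; exact/dF/(lt_trans c0 h).
  + by apply: cvg_at_right_filter; exact: cF.
  + by apply: cvg_at_left_filter; exact: cF.
- move=> x; rewrite in_itv/= => /andP[h _]; have x0 := lt_trans c0 h.
  have xp : x \in `]0, +oo[ by rewrite in_itv/= andbT.
  rewrite derive1Ml; last exact: derivable_powR.
  by rewrite powR_derive1// mulrA mulVf ?mul1r// gt_eqF.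
Qed.

Lemma gamma_kernel_lty a : 0 < a ->
  (\int[mu]_t (gamma_kernel a t)%:E < +oo)%E.
Proof.
move=> a0.
(* [t `^ (a - 1)] up to 1 and, as [t / (2 * a) <= expR (t / (2 * a))],
   [(2 * a) `^ a * expR (t / 2)] beyond *)
pose h1 (t : R) := ((fun t : R => (t `^ (a - 1))%:E) \_ `]0%R, 1%R]) t.
(* The last factor 2 cancels the rate [2^-1] in [exponential_pdf 2^-1], whose total integral is
   1. *)
pose C := (2 * a) `^ a * 2.
pose h2 (t : R) := (C%:E * (exponential_pdf 2^-1 t)%:E)%E.
have mh1 : measurable_fun setT h1.
  apply: (measurable_restrictT _ _).1 => //; apply: measurable_funTS.
  by apply/measurable_EFinP; exact: measurable_powR.
have h10 t : (0 <= h1 t)%E.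
  by rewrite /h1; apply: erestrict_ge0 => ? _; rewrite lee_fin powR_ge0.
have C0 : 0 <= C by rewrite mulr_ge0// powR_ge0.
have pdf0 t : 0 <= exponential_pdf (2^-1 : R) t by apply: exponential_pdf_ge0.
have mpdf : measurable_fun setT (fun t => (exponential_pdf (2^-1 : R) t)%:E).
  by apply/measurable_EFinP; exact: measurable_exponential_pdf.
have mh2 : measurable_fun setT h2 by exact: measurable_funeM.
have h20 t : (0 <= h2 t)%E by rewrite mule_ge0 ?lee_fin.
apply: (@le_lt_trans _ _ (\int[mu]_t (h1 t + h2 t))%E).
  apply: ge0_le_integral => //.
  - by move=> t _; rewrite lee_fin gamma_kernel_ge0.
  - by apply/measurable_EFinP; exact: measurable_gamma_kernel.
  - exact: emeasurable_funD.
  move=> t _; rewrite /gamma_kernel.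
  have [t0|t0] := ltP 0 t; last by rewrite mul0r adde_ge0.
  rewrite mul1r; have [t1|t1] := leP t 1.
    rewrite -[leLHS]adde0 leeD//.
    rewrite /h1 patchE mem_setE in_itv/= t0 t1 lee_fin.
    by rewrite ler_piMr ?powR_ge0// expR_le1 oppr_le0 ltW.
  rewrite -[leLHS]add0e leeD// /h2 -EFinM lee_fin exponential_pdfE ?(ltW t0)//.
  have a2 : 2 * a != 0 by lra.
  have -> : C * (2^-1 * expR (- (2^-1) * t)) =
            (2 * a) `^ a * expR (t / 2) * expR (- t).
    rewrite /C -!mulrA -expRD; congr (_ * _); rewrite mulrA divff// mul1r.
    by congr expR; field.
  rewrite ler_wpM2r ?expR_ge0//.
  rewrite (le_trans (_ : _ <= t `^ a))//.
    by rewrite ler_powR ?(ltW t1)// gerBl.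
  have -> : expR (t / 2) = (expR (t / (2 * a))) `^ a.
    by rewrite -expRM; congr expR; field; lra.
  rewrite -powRM ?expR_ge0 ?mulr_ge0 ?(ltW a0)//.
  apply: ge0_ler_powR; rewrite ?nnegrE ?mulr_ge0 ?expR_ge0 ?(ltW a0) ?(ltW t0)//.
  rewrite -ler_pdivrMl; last by lra.
  rewrite mulrC (le_trans _ (expR_ge1Dx _))//; lra.
rewrite ge0_integralD//.
apply: lte_add_pinfty; first by rewrite -integral_mkcond integral_powR01_lty.
rewrite ge0_integralZl_EFin//; last by move=> t _; rewrite lee_fin.
by rewrite integral_exponential_pdf ?mule1 ?ltry.
Qed.

Lemma gamma_kernel_gt0 a : 0 < a -> (0 < \int[mu]_t (gamma_kernel a t)%:E)%E.
Proof.
move=> a0; pose c := 2^-1 * expR (- 2) : R.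
have c0 : 0 < c by rewrite mulr_gt0 ?expR_gt0.
apply: (@lt_le_trans _ _ (\int[mu]_(t in `[1%R, 2%R]) c%:E)%E).
  rewrite integral_cst//= lebesgue_measure_itv/= lte_fin ltr1n -EFinB -EFinM.
  by rewrite lte_fin mulr_gt0// subr_gt0 ltr1n.
rewrite integral_mkcond; apply: ge0_le_integral => //.
- by move=> t _; apply: erestrict_ge0 => ? _; rewrite lee_fin ltW.
- by apply: (measurable_restrictT _ _).1.
- by apply/measurable_EFinP; exact: measurable_gamma_kernel.
move=> t _; rewrite patchE mem_setE in_itv/=.
case: ifPn => [/andP[t1 t2]|_]; last by rewrite lee_fin gamma_kernel_ge0.
have t0 : 0 < t by lra.
rewrite /gamma_kernel t0 mul1r lee_fin /c ler_pM ?expR_ge0 ?invr_ge0//; last first.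
  by rewrite ler_expR lerN2.
rewrite (@le_trans _ _ (t `^ (-1)))//.
  by rewrite powR_inv1 ?(ltW t0)// lef_pV2 ?posrE.
by rewrite ler_powR//; lra.
Qed.

Lemma Gamma_fineK a : 0 < a -> (Gamma a)%:E = (\int[mu]_t (gamma_kernel a t)%:E)%E.
Proof.
move=> a0; rewrite Gamma_kernelE fineK// ge0_fin_numE ?gamma_kernel_lty//.
by rewrite ltW// gamma_kernel_gt0.
Qed.

Lemma Gamma_gt0 a : 0 < a -> 0 < Gamma a.
Proof. by move=> a0; rewrite -lte_fin Gamma_fineK// gamma_kernel_gt0. Qed.

End Gamma_integral.

Section Beta_integral.
Context (R : realType).
Notation mu := (@lebesgue_measure R).
Implicit Types a b s : R.

(** Beta integrand on an interval of length [s], the room that the later coordinates of a simplex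
    leave to [u]. *)
Definition beta_kernel a b s (u : R) : R :=
  (0 < u)%R%:R * (0 < s - u)%R%:R * (u `^ (a - 1) * (s - u) `^ (b - 1)).

Lemma beta_kernel_ge0 a b s u : 0 <= beta_kernel a b s u.
Proof. by rewrite !mulr_ge0 ?powR_ge0. Qed.

Lemma measurable_beta_kernel a b s : measurable_fun setT (beta_kernel a b s).
Proof.
have ms : measurable_fun setT (fun u : R => s - u) by exact: measurable_funB.
apply: measurable_funM.
  apply: measurable_funM; first exact: measurable_pos_indic.
  exact: (measurableT_comp (@measurable_pos_indic R) ms).
apply: measurable_funM; first exact: measurable_powR.
exact: (measurableT_comp (measurable_powR _) ms).
Qed.

(** Under the dilation by [s], the two powers give [s]^ (a - 1)[and]s [^ (b - 1)], and the Jacobian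
    gives one more [s]. *)
Lemma beta_kernel_scale a b s : 0 < s ->
  (\int[mu]_u (beta_kernel a b s u)%:E =
   (s `^ (a + b - 1))%:E * \int[mu]_u (beta_kernel a b 1 u)%:E)%E.
Proof.
move=> s0.
rewrite (@ge0_integral_affine _ s 0)//; last 2 first.
- by apply/measurable_EFinP; exact: measurable_beta_kernel.
- by move=> u; rewrite lee_fin beta_kernel_ge0.
rewrite -!ge0_integralZl_EFin//; first last.
- exact: ltW.
- apply/measurable_EFinP; apply: measurableT_comp; last first.
    by apply: measurable_funD => //; exact: measurable_funM.
  exact: measurable_beta_kernel.
- by move=> u _; rewrite lee_fin beta_kernel_ge0.
- exact: powR_ge0.
- by apply/measurable_EFinP; exact: measurable_beta_kernel.
- by move=> u _; rewrite lee_fin beta_kernel_ge0.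
apply: eq_integral => u _; rewrite -!EFinM; congr EFin.
have sE : s - s * u = s * (1 - u) by ring.
rewrite /beta_kernel addr0 pmulr_rgt0// sE pmulr_rgt0//.
have [u0|] := ltP 0 u; last by rewrite !(mul0r, mulr0).
have [u1|] := ltP 0 (1 - u); last by rewrite !(mul0r, mulr0).
rewrite !mul1r !powRM ?(ltW s0) ?(ltW u0) ?(ltW u1)//.
have -> : s `^ (a + b - 1) = s * (s `^ (a - 1) * s `^ (b - 1)).
  rewrite -[X in X * _](powRr1 (ltW s0)) -!powRD ?(gt_eqF s0) ?implybT//.
  by congr powR; ring.
ring.
Qed.

(* Euler: write [Gamma a * Gamma b] as a double integral in [(x, y)] and
   substitute [z = x + y] in the inner one. *)
Lemma beta_kernel_Gamma a b : 0 < a -> 0 < b ->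
  (\int[mu]_u (beta_kernel a b 1 u)%:E = (Gamma a * Gamma b / Gamma (a + b))%:E)%E.
Proof.
move=> a0 b0.
have ab0 : 0 < a + b by rewrite addr_gt0.
pose F (p : R * R) : \bar R := (gamma_kernel a p.1 * gamma_kernel b (p.2 - p.1))%:E.
have mF : measurable_fun setT F.
  apply/measurable_EFinP; apply: measurable_funM.
    apply: (measurableT_comp (measurable_gamma_kernel a)).
    exact: measurable_fst.
  apply: (measurableT_comp (measurable_gamma_kernel b)).
  by apply: measurable_funB; [exact: measurable_snd|exact: measurable_fst].
have F0 p : (0 <= F p)%E by rewrite lee_fin mulr_ge0// gamma_kernel_ge0.
have := @fubini_tonelli _ _ _ _ _ mu mu F mF F0.
have -> : (\int[mu]_x \int[mu]_z F (x, z) = (Gamma a * Gamma b)%:E)%E.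
  transitivity (\int[mu]_x ((Gamma b)%:E * (gamma_kernel a x)%:E))%E.
    apply: eq_integral => x _; rewrite /F/=.
    under eq_integral do rewrite EFinM.
    rewrite ge0_integralZl_EFin ?gamma_kernel_ge0//; first last.
    - apply/measurable_EFinP; apply: (measurableT_comp (measurable_gamma_kernel b)).
      exact: measurable_funB.
    - by move=> z _; rewrite lee_fin gamma_kernel_ge0.
    rewrite muleC; congr (_ * _)%E.
    rewrite Gamma_fineK// [RHS](@ge0_integral_affine _ 1 (- x))//; first last.
    - by move=> u; rewrite lee_fin gamma_kernel_ge0.
    - by apply/measurable_EFinP; exact: measurable_gamma_kernel.
    by rewrite mul1e; apply: eq_integral => z _; rewrite mul1r.
  rewrite ge0_integralZl_EFin//; last 3 first.
  - by move=> x _; rewrite lee_fin gamma_kernel_ge0.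
  - by apply/measurable_EFinP; exact: measurable_gamma_kernel.
  - exact/ltW/Gamma_gt0.
  by rewrite -Gamma_fineK// -EFinM mulrC.
have -> : (\int[mu]_z \int[mu]_x F (x, z) =
   (Gamma (a + b))%:E * \int[mu]_u (beta_kernel a b 1 u)%:E)%E.
  have B0 : (0 <= \int[mu]_u (beta_kernel a b 1 u)%:E)%E.
    by apply: integral_ge0 => u _; rewrite lee_fin beta_kernel_ge0.
  rewrite muleC Gamma_fineK// -ge0_integralZl//; last 2 first.
  - by apply/measurable_EFinP; exact: measurable_gamma_kernel.
  - by move=> x _; rewrite lee_fin gamma_kernel_ge0.
  apply: eq_integral => z _; rewrite /F/=.
  (* For fixed [z] the two exponentials combine to [expR (- z)], and a Beta kernel of length [z]
     remains; its scaling produces the Gamma integrand of [a + b]. *)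
  transitivity (\int[mu]_x ((expR (- z))%:E * (beta_kernel a b z x)%:E))%E.
    apply: eq_integral => x _; rewrite -EFinM; congr EFin.
    have -> : expR (- z) = expR (- x) * expR (- (z - x)).
      by rewrite -expRD; congr expR; ring.
    by rewrite /gamma_kernel /beta_kernel; ring.
  rewrite ge0_integralZl_EFin ?expR_ge0//; last 2 first.
  - by move=> x _; rewrite lee_fin beta_kernel_ge0.
  - by apply/measurable_EFinP; exact: measurable_beta_kernel.
  have [z0|z0] := ltP 0 z.
    by rewrite beta_kernel_scale// muleCA muleA -EFinM muleC /gamma_kernel z0 mul1r.
  rewrite /gamma_kernel ltNge z0/= mul0r mule0 integral0_eq ?mule0// => x _.
  rewrite /beta_kernel; have [x0|] := ltP 0 x; last by rewrite !mul0r.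
  by rewrite ltNge (_ : z - x <= 0) ?mulr0 ?mul0r//; lra.
move/(congr1 (fun r => (Gamma (a + b))^-1%:E * r)%E).
have G0 := @Gamma_gt0 R _ ab0.
rewrite muleA -!EFinM mulVf ?gt_eqF// mul1e => <-.
by rewrite mulrC.
Qed.

Lemma integral_beta_kernel a b s : 0 < a -> 0 < b -> 0 < s ->
  (\int[mu]_u (beta_kernel a b s u)%:E =
   (Gamma a * Gamma b / Gamma (a + b) * s `^ (a + b - 1))%:E)%E.
Proof.
by move=> a0 b0 s0; rewrite beta_kernel_scale// beta_kernel_Gamma// -EFinM mulrC.
Qed.

End Beta_integral.

(** * Iterated and Dirichlet integrals *)

Section iterated_integral.
Context (R : realType) (d : measure_display) (T : measurableType d).
Variable mu : nat -> {measure set T -> \bar R}.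
Local Notation iintm := (iint (fun k => (mu k : set T -> \bar R))).
Implicit Types (x : nat -> T) (h : (nat -> T) -> \bar R) (phi : nat -> T -> R).

Lemma upd_id x k u : upd x k u k = u.
Proof. by rewrite /upd eqxx. Qed.

Lemma upd_neq x k u j : j != k -> upd x k u j = x j.
Proof. by rewrite /upd => /negPf ->. Qed.

Lemma iint_ge0 h k x : (forall x, (0 <= h x)%E) -> (0 <= iintm k h x)%E.
Proof. by move=> h0; elim: k x => //= k IH x; exact: integral_ge0. Qed.

(** One-variable linearity is applied once per coordinate. Measurability is asked only of each
    partial integral in its next variable. The coefficients are extended reals because integrals
    over component parameters may be infinite. *)
Lemma iint_lincomb (I : Type) (s : seq I) (K : I -> \bar R)
    (h : I -> (nat -> T) -> \bar R) k x :
  (forall i, (0 <= K i)%E) -> (forall i x, (0 <= h i x)%E) ->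
  (forall i x j, (j < k)%N ->
     measurable_fun setT (fun u => iintm j (h i) (upd x j u))) ->
  iintm k (fun x => \sum_(i <- s) K i * h i x)%E x =
  (\sum_(i <- s) K i * iintm k (h i) x)%E.
Proof.
move=> K0 h0; elim: k x => [//|k IH] x mh /=.
transitivity (\int[mu k]_u
    (\sum_(i <- s) K i * iintm k (h i) (upd x k u)))%E.
  by apply: eq_integral => u _; rewrite IH// => i z j jk; exact/mh/ltnW.
rewrite ge0_integral_sum//.
- apply: eq_bigr => i _; rewrite ge0_integralZl//; first exact: mh.
  by move=> u _; exact: iint_ge0.
- by move=> i; apply: measurable_funeM; exact: mh.
- by move=> i u _; rewrite mule_ge0// iint_ge0.
Qed.

Section product_integrand.
Variables (phi : nat -> T -> R) (N : nat).
Hypothesis phi_ge0 : forall g u, 0 <= phi g u.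
Hypothesis mphi : forall g, measurable_fun setT (phi g).

(** Updating coordinate [k] leaves the factors above [k] unchanged, so they come out of the
    integral. Every [k <= N] is covered because [iint_lincomb] asks for measurable partial
    integrals. *)
Lemma iint_prod k x : (k <= N)%N ->
  iintm k (fun x => (\prod_(0 <= g < N) phi g (x g))%:E) x =
  ((\prod_(0 <= g < k) \int[mu g]_u (phi g u)%:E) *
   (\prod_(k <= g < N) phi g (x g))%:E)%E.
Proof.
elim: k x => [|k IH] x kN; first by rewrite (big_geq (leqnn 0)) mul1e.
rewrite /=; pose W := \prod_(k.+1 <= g < N) phi g (x g).
have W0 : 0 <= W by rewrite prodr_ge0.
have J0 : (0 <= \prod_(0 <= g < k) \int[mu g]_u (phi g u)%:E)%E.
  by apply: prode_ge0 => g _; apply: integral_ge0 => u _; rewrite lee_fin.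
transitivity (\int[mu k]_u ((\prod_(0 <= g < k) \int[mu g]_u (phi g u)%:E) *
    W%:E * (phi k u)%:E))%E.
  apply: eq_integral => u _; rewrite IH 1?ltnW//.
  rewrite big_ltn// upd_id EFinM -muleA; congr (_ * _)%E.
  rewrite muleC; congr (_%:E * _)%E; apply: eq_big_nat => g /andP[kg _].
  by rewrite upd_neq// gtn_eqF.
rewrite ge0_integralZl//; last 3 first.
- by apply/measurable_EFinP; exact: mphi.
- by move=> u _; rewrite lee_fin.
- by rewrite mule_ge0.
by rewrite big_nat_recr//= muleAC.
Qed.

Lemma measurable_iint_prod k x : (k < N)%N ->
  measurable_fun setT (fun u =>
    iintm k (fun x => (\prod_(0 <= g < N) phi g (x g))%:E) (upd x k u)).
Proof.
move=> kN; under eq_fun do rewrite iint_prod 1?ltnW// big_ltn// upd_id.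
apply: measurable_funeM; apply/measurable_EFinP.
apply: measurable_funM; first exact: mphi.
rewrite (_ : (fun _ => _) = cst (\prod_(k.+1 <= g < N) phi g (x g)))//.
apply/funext => u; apply: eq_big_nat => g /andP[kg _].
by rewrite upd_neq// gtn_eqF.
Qed.

End product_integrand.
End iterated_integral.

Section Dirichlet_integral.
Context (R : realType) (a : nat -> R) (b : R) (K : nat).
Hypothesis a_gt0 : forall j, (j < K)%N -> 0 < a j.
Hypothesis b_gt0 : 0 < b.
Local Notation leb := (fun _ : nat => @lebesgue_measure R).
Implicit Type t : nat -> R.

(* Dirichlet density, up to its constant, after integrating out the coordinates
   below [k], whose exponents have moved to the last weight. *)
Definition dir_kernel k t : R :=
  (\prod_(k <= j < K) ((0 < t j)%R%:R * t j `^ (a j - 1))) *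
  ((0 < 1 - \sum_(k <= j < K) t j)%R%:R *
   (1 - \sum_(k <= j < K) t j) `^ (b + \sum_(0 <= j < k) a j - 1)).

(** Telescoped product of the Beta values Γ(a_j)Γ(b_j)/Γ(a_j + b_j) for j < k, where b_j = b + a_0 +
    ... + a_(j-1). *)
Definition dir_cst k : R :=
  \prod_(0 <= j < k) Gamma (a j) * Gamma b / Gamma (b + \sum_(0 <= j < k) a j).

Lemma dir_kernel_ge0 k t : 0 <= dir_kernel k t.
Proof.
apply: mulr_ge0; last by rewrite mulr_ge0// powR_ge0.
by apply: prodr_ge0 => j _; rewrite mulr_ge0// powR_ge0.
Qed.

Lemma dir_kernel_upd k t u : (k < K)%N ->
  dir_kernel k (upd t k u) =
  \prod_(k.+1 <= j < K) ((0 < t j)%R%:R * t j `^ (a j - 1)) *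
  beta_kernel (a k) (b + \sum_(0 <= j < k) a j)
    (1 - \sum_(k.+1 <= j < K) t j) u.
Proof.
move=> kK; rewrite /dir_kernel.
have tE j : (k.+1 <= j < K)%N -> upd t k u j = t j.
  by move=> /andP[kj _]; rewrite upd_neq// gtn_eqF.
rewrite !(big_ltn kK) upd_id (eq_big_nat _ _ tE).
rewrite (eq_big_nat _ _ (F2 := fun j => (0 < t j)%R%:R * t j `^ (a j - 1))).
  rewrite /beta_kernel (_ : 1 - (u + _) = 1 - \sum_(k.+1 <= j < K) t j - u).
    by ring.
  by ring.
by move=> j jk; rewrite tE.
Qed.

Let b_k_gt0 k : (k <= K)%N -> 0 < b + \sum_(0 <= j < k) a j.
Proof.
move=> kK; rewrite ltr_wpDr// big_nat_cond sumr_ge0// => j.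
by rewrite andbT => /andP[_ jk]; rewrite ltW// a_gt0// (leq_trans jk).
Qed.

(** Integrating coordinate [k] is a Beta integral of length [S]; it adds [a k] to the exponent of
    the last weight and one factor to the telescoping constant. If [S <= 0], both sides vanish. *)
Lemma iint_dir_kernel k t : (k <= K)%N ->
  iint leb k (fun t => (dir_kernel 0 t)%:E) t = (dir_cst k * dir_kernel k t)%:E.
Proof.
elim: k t => [|k IH] t kK.
  by rewrite /dir_cst !big_geq// addr0 mul1r divff ?mul1r// gt_eqF ?Gamma_gt0.
rewrite /=; set W := \prod_(k.+1 <= j < K) ((0 < t j)%R%:R * t j `^ (a j - 1)).
set S := 1 - \sum_(k.+1 <= j < K) t j.
have W0 : 0 <= W by apply: prodr_ge0 => j _; rewrite mulr_ge0// powR_ge0.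
have bk0 := b_k_gt0 (ltnW kK); set bk := b + _ in bk0.
have C0 : 0 <= dir_cst k.
  rewrite divr_ge0 ?(ltW (Gamma_gt0 bk0))// mulr_ge0 ?(ltW (Gamma_gt0 b_gt0))//.
  rewrite big_nat_cond prodr_ge0// => j; rewrite andbT => /andP[_ jk].
  by rewrite ltW// Gamma_gt0// a_gt0// (ltn_trans jk).
transitivity (\int[@lebesgue_measure R]_u
    ((dir_cst k * W)%:E * (beta_kernel (a k) bk S u)%:E))%E.
  by apply: eq_integral => u _; rewrite IH 1?ltnW// dir_kernel_upd// mulrA EFinM.
rewrite ge0_integralZl_EFin ?(mulr_ge0 C0 W0)//; last 2 first.
- by move=> u _; rewrite lee_fin beta_kernel_ge0.
- by apply/measurable_EFinP; exact: measurable_beta_kernel.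
rewrite /dir_kernel -/W -/S; have [S0|S0] := ltP 0 S; last first.
  rewrite mul0r !mulr0 integral0_eq ?mule0// => u _.
  rewrite /beta_kernel; have [u0|] := ltP 0 u; last by rewrite !mul0r.
  by rewrite ltNge (_ : S - u <= 0) ?mulr0 ?mul0r//; lra.
rewrite integral_beta_kernel ?a_gt0// -EFinM mul1r; congr EFin.
rewrite /dir_cst !big_nat_recr//= -/bk.
rewrite (_ : b + (_ + a k) = a k + bk); last by rewrite /bk; ring.
have := Gamma_gt0 bk0; have := Gamma_gt0 (addr_gt0 (a_gt0 kK) bk0).
by move=> /gt_eqF/negbT g1 /gt_eqF/negbT g2; field; rewrite g1 g2.
Qed.

Lemma measurable_iint_dir_kernel k t : (k < K)%N ->
  measurable_fun setT
    (fun u => iint leb k (fun t => (dir_kernel 0 t)%:E) (upd t k u)).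
Proof.
move=> kK; under eq_fun do rewrite iint_dir_kernel 1?ltnW// dir_kernel_upd//.
apply/measurable_EFinP; do 2 apply: measurable_funM => //.
exact: measurable_beta_kernel.
Qed.

Lemma iint_dir_kernelT t :
  iint leb K (fun t => (dir_kernel 0 t)%:E) t = (dir_cst K)%:E.
Proof.
by rewrite iint_dir_kernel// /dir_kernel !(big_geq (leqnn K)) subr0 ltr01 powR1 !mulr1.
Qed.

End Dirichlet_integral.

(** * Allocations and Dirichlet moments *)

Section fibers.
Context (R : realType) (n : nat) (c : 'I_n -> nat).

(** Allocations take values in [nat], so that one allocation can be read in the models with [K] and
    with [K.+1] components. *)
Definition fiber_size (g : nat) : nat := #|[pred i | c i == g]|.

Lemma big_fibers (S : Type) (idx : S) (op : Monoid.com_law idx) (N : nat)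
    (F : 'I_n -> S) : (forall i, c i < N)%N ->
  \big[op/idx]_(0 <= g < N) \big[op/idx]_(i | c i == g) F i =
  \big[op/idx]_i F i.
Proof.
move=> cN; rewrite big_mkord.
rewrite (eq_bigr _ (fun g _ => big_mkcond _ _)).
rewrite exchange_big; apply: eq_bigr => i _.
rewrite (bigD1 (Ordinal (cN i)))//= eqxx big1 ?Monoid.mulm1// => g.
by rewrite -val_eqE/= eq_sym => /negPf ->.
Qed.

Lemma prod_fiber_size (N : nat) (w : nat -> R) : (forall i, c i < N)%N ->
  \prod_i w (c i) = \prod_(0 <= g < N) w g ^+ fiber_size g.
Proof.
move=> cN; rewrite -(big_fibers _ _ cN); apply: eq_bigr => g _.
by rewrite (eq_bigr (fun=> w g)) ?prodr_const// => i /eqP ->.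
Qed.

Lemma sum_fiber_size (N : nat) : (forall i, c i < N)%N ->
  \sum_(0 <= g < N) (fiber_size g)%:R = n%:R :> R.
Proof.
move=> cN; rewrite -natr_sum; congr _%:R.
under eq_bigr do rewrite /fiber_size -sum1_card.
by rewrite big_fibers// sum1_card card_ord.
Qed.

End fibers.

Section Dirichlet_moments.
Context (R : realType) (e : nat -> R) (K n : nat).
Hypothesis e_gt0 : forall g, (g < K.+1)%N -> 0 < e g.
Implicit Types (t : nat -> R) (c : 'I_n -> nat).

(** The Dirichlet-multinomial probability of the allocation [c], that is, the Dirichlet expectation
    of the product of the weights [tau (c i)]. *)
Definition dir_moment (G : nat) c : R :=
  Gamma (\sum_(0 <= g < G) e g) / \prod_(0 <= g < G) Gamma (e g) *
  (\prod_(0 <= g < G) Gamma (e g + (fiber_size c g)%:R) /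
   Gamma (n%:R + \sum_(0 <= g < G) e g)).

Lemma tau_of_lt t g : (g < K)%N -> tau_of K.+1 t g = t g.
Proof. by move=> gK; rewrite /tau_of/= gK. Qed.

Lemma tau_of_last t : tau_of K.+1 t K = 1 - \sum_(0 <= j < K) t j.
Proof. by rewrite /tau_of/= ltnn eqxx big_mkord. Qed.

Lemma in_simplex_tau_gt0 t g : in_simplex K.+1 t -> (g < K.+1)%N ->
  0 < tau_of K.+1 t g.
Proof.
move=> /andP[/forallP/= t0 t1]; rewrite ltnS leq_eqVlt => /predU1P[->|gK].
  by rewrite tau_of_last subr_gt0 big_mkord.
by rewrite tau_of_lt// (t0 (Ordinal gK)).
Qed.

Lemma dir_dens_out t : ~~ in_simplex K.+1 t -> dir_dens e K.+1 t = 0.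
Proof. by move=> /negPf tS; rewrite /dir_dens tS !mul0r. Qed.

(** Conjugacy: each observation in component [g] raises the exponent of its weight by one. Off the
    simplex some indicator in [dir_kernel] is zero. *)
Lemma dir_dens_monomial t c : (forall i, c i < K.+1)%N ->
  dir_dens e K.+1 t * \prod_i tau_of K.+1 t (c i) =
  Gamma (\sum_(0 <= g < K.+1) e g) / \prod_(0 <= g < K.+1) Gamma (e g) *
  dir_kernel (fun g => e g + (fiber_size c g)%:R)
             (e K + (fiber_size c K)%:R) K 0 t.
Proof.
move=> cK; have [tS|tS] := boolP (in_simplex K.+1 t); last first.
  rewrite dir_dens_out// mul0r; set k := (X in _ * X).
  suff -> : k = 0 by rewrite mulr0.
  rewrite {}/k /dir_kernel.
  move: tS; rewrite negb_and => /orP[/forallPn[/= j /negPf tj]|].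
    rewrite big_mkord (bigD1 j)//= tj.
    by rewrite !mul0r.
  by rewrite /= -leNgt -subr_le0 leNgt !big_mkord => /negPf ->; rewrite mul0r mulr0.
rewrite /dir_dens tS mul1r (prod_fiber_size _ cK) !big_mkord -mulrA.
congr (_ * _); rewrite -big_split/=.
have E g : (g < K.+1)%N ->
    tau_of K.+1 t g `^ (e g - 1) * tau_of K.+1 t g ^+ fiber_size c g =
    tau_of K.+1 t g `^ (e g + (fiber_size c g)%:R - 1).
  move=> gK; have g0 := in_simplex_tau_gt0 tS gK.
  rewrite -powR_mulrn ?(ltW g0)// -powRD ?(gt_eqF g0) ?implybT//.
  by congr powR; ring.
rewrite big_ord_recr/= E// /dir_kernel (big_geq (leqnn 0)) addr0 !tau_of_last.
have := in_simplex_tau_gt0 tS (ltnSn K); rewrite tau_of_last => ->; rewrite mul1r.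
congr (_ * _); rewrite big_mkord; apply: eq_bigr => j _.
rewrite E; last by rewrite ltnS ltnW.
have := @in_simplex_tau_gt0 t j tS; rewrite tau_of_lt// => ->; first by rewrite mul1r.
by rewrite ltnS ltnW.
Qed.

Lemma dir_momentE c : (forall i, c i < K.+1)%N ->
  dir_moment K.+1 c =
  Gamma (\sum_(0 <= g < K.+1) e g) / \prod_(0 <= g < K.+1) Gamma (e g) *
  dir_cst (fun g => e g + (fiber_size c g)%:R) (e K + (fiber_size c K)%:R) K.
Proof.
move=> cK; rewrite /dir_moment /dir_cst; congr (_ * (_ / Gamma _)).
  by rewrite [LHS]big_nat_recr.
rewrite -(sum_fiber_size R cK) -big_split/= big_nat_recr//= addrC.
rewrite [X in X + _]addrC; congr (_ + _).
by apply: eq_bigr => j _; rewrite addrC.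
Qed.

Lemma dir_moment_ge0 G c : (0 < G <= K.+1)%N -> 0 <= dir_moment G c.
Proof.
move=> /andP[G0 GK].
have eG g : (g < G)%N -> 0 < e g by move=> gG; rewrite e_gt0// (leq_trans gG).
have s0 : 0 < \sum_(0 <= g < G) e g.
  rewrite big_mkord (bigD1 (Ordinal G0))//= ltr_wpDr ?eG//.
  by apply: sumr_ge0 => g _; rewrite ltW// eG.
rewrite /dir_moment mulr_ge0// divr_ge0//.
- by rewrite ltW// Gamma_gt0.
- by rewrite big_mkord prodr_ge0// => g _; rewrite ltW// Gamma_gt0// eG.
- by rewrite big_mkord prodr_ge0// => g _; rewrite ltW// Gamma_gt0// ltr_wpDr// eG.
- by rewrite ltW// Gamma_gt0// ltr_wpDl.
Qed.

(** The last component is empty, so its factor [Gamma (e K)] occurs in the moment and in the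
    normalising constant and cancels. Only the Gamma values of the totals differ between the two
    models. *)
Lemma dir_moment_avoid_last c : (0 < K)%N -> (forall i, c i < K)%N ->
  dir_moment K.+1 c =
  Gamma (\sum_(0 <= g < K.+1) e g) * Gamma (n%:R + \sum_(0 <= g < K) e g) /
  (Gamma (n%:R + \sum_(0 <= g < K.+1) e g) * Gamma (\sum_(0 <= g < K) e g)) *
  dir_moment K c.
Proof.
move=> K0 cK; have c0 : fiber_size c K = 0%N.
  by apply: eq_card0 => i; rewrite inE ltn_eqF.
have s0 : 0 < \sum_(0 <= g < K) e g.
  rewrite big_mkord (bigD1 (Ordinal K0))//= ltr_wpDr ?e_gt0//.
  by apply: sumr_ge0 => g _; rewrite ltW// e_gt0// ltnS ltnW.
have p0 : 0 < \prod_(0 <= g < K) Gamma (e g).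
  rewrite big_mkord prodr_gt0// => g _; rewrite Gamma_gt0// e_gt0//.
  by rewrite ltnS ltnW.
have g0 := Gamma_gt0 s0.
have g1 : 0 < Gamma (n%:R + \sum_(0 <= g < K) e g) by rewrite Gamma_gt0// ltr_wpDl.
have g2 : 0 < Gamma (n%:R + \sum_(0 <= g < K.+1) e g).
  by rewrite Gamma_gt0// ltr_wpDl// big_nat_recr//= addr_gt0// e_gt0.
have g3 := Gamma_gt0 (e_gt0 (ltnSn K)).
rewrite /dir_moment [\prod_(0 <= g < K.+1) Gamma (e g)]big_nat_recr//=.
rewrite [\prod_(0 <= g < K.+1) Gamma _]big_nat_recr//= c0 addr0.
by field; rewrite !gt_eqF.
Qed.

End Dirichlet_moments.

(** * Prior expectations of allocation monomials *)

Section mixture_prior.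
Context (R : realType) (d : measure_display) (Xi : measurableType d).
Context (Y : Type) (n : nat) (y : 'I_n -> Y) (f : Y -> Xi -> R).
Context (e : nat -> R) (pi : nat -> probability Xi R) (K : nat).
Hypothesis f_ge0 : forall yv u, 0 <= f yv u.
Hypothesis mf : forall yv, measurable_fun setT (f yv).
Hypothesis e_gt0 : forall g, (g < K.+1)%N -> 0 < e g.
Local Notation param := (@param R d Xi).
Implicit Types (c : 'I_n -> nat) (th : param).

(** Joint density of the data and the allocation [c] given the parameter. *)
Definition monomial c th : R := \prod_i (th.1 (c i) * f (y i) (th.2 (c i))).

(** Density of the data given the allocation [c], with the component parameters integrated out. *)
Definition comp_int (G : nat) c : \bar R :=
  (\prod_(0 <= g < G) \int[pi g]_u (\prod_(i | c i == g) f (y i) u)%:E)%E.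

(** The Dirichlet density vanishes off the simplex; this lets later arguments assume positive
    weights. *)
Lemma eq_prior_expect (h1 h2 : param -> \bar R) :
  (forall t x, in_simplex K.+1 t ->
     h1 (tau_of K.+1 t, x) = h2 (tau_of K.+1 t, x)) ->
  prior_expect e pi K.+1 h1 = prior_expect e pi K.+1 h2.
Proof.
move=> h12; rewrite /prior_expect; congr (iint _ _ _ _); apply/funext => t.
have [tS|tS] := boolP (in_simplex K.+1 t); last by rewrite dir_dens_out// !mul0e.
congr (_ * iint _ _ _ _)%E; apply/funext => x; exact: h12.
Qed.

Lemma comp_int_ge0 G c : (0 <= comp_int G c)%E.
Proof.
apply: prode_ge0 => g _; apply: integral_ge0 => u _.
by rewrite lee_fin prodr_ge0.
Qed.

Let phi c g (u : Xi) : R := \prod_(i | c i == g) f (y i) u.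

Let phi_ge0 c g u : 0 <= phi c g u. Proof. exact: prodr_ge0. Qed.

Let mphi c g : measurable_fun setT (phi c g).
Proof.
rewrite /phi; under eq_fun do rewrite -big_filter.
by apply: measurable_prod => i _; exact: mf.
Qed.

Let prod_phi G c (x : nat -> Xi) : (forall i, c i < G)%N ->
  \prod_i f (y i) (x (c i)) = \prod_(0 <= g < G) phi c g (x g).
Proof.
move=> cG; rewrite -(big_fibers _ _ cG); apply: eq_bigr => g _.
by apply: eq_bigr => i /eqP ->.
Qed.

Lemma iint_monomials (I : Type) (s : seq I) (c : I -> 'I_n -> nat) (G : nat)
    (r : R) (tau : nat -> R) (x : nat -> Xi) : 0 <= r ->
  (forall i j, c i j < G)%N -> (forall g, (g < G)%N -> 0 <= tau g) ->
  iint (fun g => (pi g : set Xi -> \bar R)) G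
    (fun x => (r * \sum_(i <- s) monomial (c i) (tau, x))%:E) x =
  (\sum_(i <- s) (r * \prod_j tau (c i j))%:E * comp_int G (c i))%E.
Proof.
move=> r0 cG tau0.
rewrite (_ : (fun x => _) = (fun x => \sum_(i <- s) (r * \prod_j tau (c i j))%:E *
    (\prod_(0 <= g < G) phi (c i) g (x g))%:E)%E); last first.
  apply/funext => z; rewrite mulr_sumr -sumEFin; apply: eq_bigr => i _.
  by rewrite /monomial big_split/= -EFinM (prod_phi z (cG i)) mulrA.
rewrite (@iint_lincomb _ _ _ pi).
- apply: eq_bigr => i _; rewrite (@iint_prod _ _ _ pi)//.
  by rewrite (big_geq (leqnn G)) mule1.
- by move=> i; rewrite lee_fin mulr_ge0// prodr_ge0// => j _; exact: tau0.
- by move=> i z; rewrite lee_fin prodr_ge0.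
- by move=> i z k kG; exact: (@measurable_iint_prod _ _ _ pi).
Qed.

(** For fixed weights, each monomial is a product over components and integrates to [comp_int]; the
    remaining function of the weights is a Dirichlet kernel. The scalar [r] and the sequence [s]
    accommodate averages and sums over restricted allocations. *)
Lemma prior_expect_monomials (I : Type) (s : seq I) (c : I -> 'I_n -> nat)
    (r : R) : 0 <= r -> (forall i j, c i j < K.+1)%N ->
  prior_expect e pi K.+1 (fun th => (r * \sum_(i <- s) monomial (c i) th)%:E) =
  (r%:E * \sum_(i <- s)
     (dir_moment e K.+1 (c i))%:E * comp_int K.+1 (c i))%E.
Proof.
move=> r0 cK; rewrite /prior_expect.
pose C := Gamma (\sum_(0 <= g < K.+1) e g) / \prod_(0 <= g < K.+1) Gamma (e g).
have C0 : 0 <= C.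
  rewrite divr_ge0//; last first.
    by rewrite big_mkord prodr_ge0// => g _; apply/ltW/Gamma_gt0/e_gt0.
  apply/ltW/Gamma_gt0; rewrite big_mkord big_ord_recr/= ltr_wpDl ?e_gt0//.
  by apply: sumr_ge0 => g _; rewrite ltW// e_gt0// ltnS ltnW.
pose a i g := e g + (fiber_size (c i) g)%:R.
have a_gt0 i g : (g < K.+1)%N -> 0 < a i g by move=> gK; rewrite ltr_wpDr// e_gt0.
rewrite (_ : (fun t => _) = (fun t => \sum_(i <- s)
    ((r * C)%:E * comp_int K.+1 (c i)) * (dir_kernel (a i) (a i K) K 0 t)%:E)%E).
  rewrite (@iint_lincomb _ _ _ (fun=> @lebesgue_measure R)).
  - rewrite ge0_sume_distrr; last first.
      by move=> i _; rewrite mule_ge0 ?comp_int_ge0// lee_fin (@dir_moment_ge0 _ _ K)//=.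
    apply: eq_bigr => i _; rewrite iint_dir_kernelT; last 2 first.
    - by move=> j jK; rewrite a_gt0// ltnW.
    - exact: a_gt0.
    transitivity ((r * (C * dir_cst (a i) (a i K) K))%:E * comp_int K.+1 (c i))%E.
      by rewrite muleAC -EFinM mulrA.
    by rewrite muleA -EFinM dir_momentE.
  - by move=> i; rewrite mule_ge0 ?comp_int_ge0// lee_fin mulr_ge0.
  - by move=> i t; rewrite lee_fin dir_kernel_ge0.
  - move=> i t k kK; apply: measurable_iint_dir_kernel => //; last exact: a_gt0.
    by move=> j jK; rewrite a_gt0// ltnW.
apply/funext => t.
transitivity (\sum_(i <- s) (r * (dir_dens e K.+1 t *
    \prod_j tau_of K.+1 t (c i j)))%:E * comp_int K.+1 (c i))%E; last first.
  apply: eq_bigr => i _.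
  by rewrite (dir_dens_monomial _ _ (cK i)) muleAC -EFinM mulrA.
have [tS|tS] := boolP (in_simplex K.+1 t); last first.
  by rewrite dir_dens_out// mul0e big1// => i _; rewrite mul0r mulr0 mul0e.
have tau0 g : (g < K.+1)%N -> 0 <= tau_of K.+1 t g.
  by move=> gK; rewrite ltW// in_simplex_tau_gt0.
rewrite iint_monomials// ge0_sume_distrr; last first.
  move=> i _; rewrite mule_ge0 ?comp_int_ge0// lee_fin mulr_ge0//.
  by apply: prodr_ge0 => j _; exact: tau0.
by apply: eq_bigr => i _; rewrite muleA -EFinM mulrCA.
Qed.

End mixture_prior.

(** * Likelihood avoiding a component *)

Section relabelling.
Context (R : realType) (d : measure_display) (Xi : measurableType d).
Local Notation param := (@param R d Xi).

Lemma measurable_ParG_weight (G g : nat) : (g < G)%N ->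
  measurable_fun setT (fun th : ParG G => (th : param).1 g).
Proof.
move=> gG _ B mB; rewrite setTI; apply: sub_sigma_algebra.
exists (fun j => if j == g then B else setT), (fun=> setT); split.
  by move=> j; split => //; case: ifP.
apply/seteqP; split => th /= thB.
  by move=> j _; split => //; case: eqP => // ->.
by have [] := thB g gG; rewrite eqxx.
Qed.

Lemma measurable_ParG_comp (G g : nat) : (g < G)%N ->
  measurable_fun setT (fun th : ParG G => (th : param).2 g).
Proof.
move=> gG _ B mB; rewrite setTI; apply: sub_sigma_algebra.
exists (fun=> setT), (fun j => if j == g then B else setT); split.
  by move=> j; split => //; case: ifP.
apply/seteqP; split => th /= thB.
  by move=> j _; split => //; case: eqP => // ->.
by have [] := thB g gG; rewrite eqxx.
Qed.

End relabelling.

Section empty_component.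
Context (R : realType) (d : measure_display) (Xi : measurableType d).
Context (Y : Type) (n : nat) (y : 'I_n -> Y) (f : Y -> Xi -> R).
Context (e : nat -> R) (pi : nat -> probability Xi R) (K : nat).
Hypothesis K_gt0 : (0 < K)%N.
Hypothesis f_ge0 : forall yv u, 0 <= f yv u.
Hypothesis mf : forall yv, measurable_fun setT (f yv).
Hypothesis e_gt0 : forall g, (g < K.+1)%N -> 0 < e g.
Hypothesis exch : relabel_invariant e pi K.+1.
Local Notation param := (@param R d Xi).
Local Notation E := (prior_expect e pi K.+1).
Local Notation mono c := (monomial y f (fun i => val (c i))).
Implicit Types th : param.

Definition avoid_lik (G g : nat) th : R :=
  \prod_i \sum_(j < G | val j != g) th.1 j * f (y i) (th.2 j).

Lemma lik_monomials G th :
  lik y f G th = \sum_(c : {ffun 'I_n -> 'I_G}) mono c th.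
Proof. by rewrite /lik bigA_distr_bigA. Qed.

Lemma avoid_lik_monomials G g th : avoid_lik G g th =
  \sum_(c : {ffun 'I_n -> 'I_G} | [forall i, val (c i) != g]) mono c th.
Proof.
rewrite /avoid_lik bigA_distr_big; apply: eq_bigl => c.
by apply/ffun_onP/forallP => h i; exact: h.
Qed.

(** On the right, [lik] with [K] components is evaluated at the weights of the larger model, which
    are not renormalised. *)
Lemma avoid_lik_last th : avoid_lik K.+1 K th = lik y f K th.
Proof.
apply: eq_bigr => i _; rewrite big_mkcond big_ord_recr/= eqxx addr0.
by apply: eq_bigr => j _; rewrite ltn_eqF.
Qed.

(** Marginal density of the data together with the allocation [c]. *)
Definition prior_monomial (c : 'I_n -> nat) : \bar R :=
  ((dir_moment e K.+1 c)%:E * comp_int y f pi K.+1 c)%E.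

Lemma prior_expect_avoid_lik g :
  E (fun th => (avoid_lik K.+1 g th)%:E) =
  (\sum_(c : {ffun 'I_n -> 'I_K.+1} | [forall i, val (c i) != g])
     prior_monomial (fun i => val (c i)))%E.
Proof.
under eq_fun do rewrite avoid_lik_monomials -[X in X%:E]mul1r -big_filter.
by rewrite prior_expect_monomials// ?mul1e ?big_filter// => c j; exact: ltn_ord.
Qed.

Lemma prior_expect_monomial (c : {ffun 'I_n -> 'I_K.+1}) :
  E (fun th => (mono c th)%:E) = prior_monomial (fun i => val (c i)).
Proof.
transitivity (E (fun th => (1 * \sum_(i <- [:: tt]) mono c th)%:E)).
  by congr prior_expect; apply/funext => th; rewrite big_seq1 mul1r.
rewrite prior_expect_monomials// ?big_seq1 ?mul1e// => _ j.
exact: ltn_ord.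
Qed.

(** Both sides are sums over the same maps into ['I_K], compared term by term:
    [dir_moment_avoid_last] gives the constant, and [comp_int] is the same for [K] and [K.+1]. *)
Lemma prior_expect_avoid_last :
  E (fun th => (avoid_lik K.+1 K th)%:E) =
  ((Gamma (\sum_(g < K.+1) e g) * Gamma (n%:R + \sum_(g < K) e g) /
    (Gamma (n%:R + \sum_(g < K.+1) e g) * Gamma (\sum_(g < K) e g)))%:E *
   marg_lik y f e pi K)%E.
Proof.
have eK g : (g < K.-1.+1)%N -> 0 < e g.
  by rewrite prednK// => gK; rewrite e_gt0// ltnS ltnW.
rewrite /marg_lik.
under eq_fun do rewrite avoid_lik_last lik_monomials -[X in X%:E]mul1r.
under [X in (_ * prior_expect _ _ _ X)%E]eq_fun
  do rewrite lik_monomials -[X in X%:E]mul1r.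
rewrite prior_expect_monomials//; last first.
  by move=> c j; exact: (ltnW (ltn_ord (c j))).
have := @prior_expect_monomials _ _ _ _ _ y f e pi K.-1 f_ge0 mf eK.
rewrite prednK// => ->//; last by move=> c j; exact: ltn_ord.
rewrite !mul1e ge0_sume_distrr; last first.
  move=> c _; rewrite mule_ge0 ?comp_int_ge0// lee_fin.
  by rewrite (dir_moment_ge0 e_gt0)// K_gt0/=.
apply: eq_bigr => c _.
rewrite dir_moment_avoid_last// ?big_mkord; last by move=> i; exact: ltn_ord.
rewrite EFinM -muleA; congr (_ * (_ * _))%E.
rewrite /comp_int big_nat_recr//=.
(* The extra factor belongs to the empty component [K]: an empty product integrated against a
   probability. *)
rewrite [X in (_ * X)%E](_ : _ = 1%E) ?mule1//.
rewrite (eq_integral (cst 1%E)) ?integral_cst//.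
  by rewrite mul1e; exact: probability_setT.
move=> u _ /=.
by rewrite big_pred0// => i; rewrite ltn_eqF.
Qed.

(* [relabel_invariant] only applies to functions that are nonnegative
   everywhere, including at parameters with negative weights. *)
Definition avoid_lik_pos (g : nat) th : R :=
  \prod_i \sum_(j < K.+1 | val j != g) Num.max (th.1 j) 0 * f (y i) (th.2 j).

Lemma measurable_avoid_lik_pos g :
  measurable_fun setT (fun th : ParG K.+1 => (avoid_lik_pos g th)%:E).
Proof.
apply/measurable_EFinP; apply: measurable_prod => i _.
rewrite (_ : (fun th => _) = (fun th : ParG K.+1 =>
    \sum_(j <- [seq j <- index_enum 'I_K.+1 | val j != g])
      Num.max ((th : param).1 j) 0 * f (y i) ((th : param).2 j))).
  2: by apply/funext => th; rewrite big_filter.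
apply: measurable_sum => j; apply: measurable_funM.
  by apply: measurable_maxr => //; exact: measurable_ParG_weight.
apply: (measurableT_comp (mf (y i))); exact: measurable_ParG_comp.
Qed.

(** The transposition sends the indices different from [g] onto those different from [K], the value
    of [ord_max]. *)
Lemma avoid_lik_pos_relabel (g : 'I_K.+1) th :
  avoid_lik_pos g (relabel (tperm g ord_max) th) = avoid_lik_pos K th.
Proof.
apply: eq_bigr => i _.
rewrite [RHS](reindex_inj (@perm_inj _ (tperm g ord_max))).
apply: eq_big => [j|j _]; last by rewrite /= /permn valK.
transitivity (tperm g ord_max j != tperm g ord_max g); last by rewrite tpermL.
by rewrite (inj_eq perm_inj).
Qed.

Lemma prior_expect_avoid_lik_pos g :
  E (fun th => (avoid_lik K.+1 g th)%:E) = E (fun th => (avoid_lik_pos g th)%:E).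
Proof.
apply: eq_prior_expect => t x tS; congr EFin.
apply: eq_bigr => i _; apply: eq_bigr => j _.
by rewrite max_l//= ltW// in_simplex_tau_gt0.
Qed.

Lemma prior_expect_avoid_sym (g : 'I_K.+1) :
  E (fun th => (avoid_lik K.+1 g th)%:E) = E (fun th => (avoid_lik K.+1 K th)%:E).
Proof.
rewrite !prior_expect_avoid_lik_pos.
rewrite -(exch (tperm g ord_max) (measurable_avoid_lik_pos g)).
  by congr prior_expect; apply/funext => th; rewrite avoid_lik_pos_relabel.
move=> th; rewrite lee_fin prodr_ge0// => i _; rewrite sumr_ge0// => j _.
by rewrite mulr_ge0// le_max lexx orbT.
Qed.

Lemma empty_stat_lik t x : in_simplex K.+1 t ->
  let th := (tau_of K.+1 t, x) in
  empty_stat y f K.+1 th * lik y f K.+1 th =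
  K.+1%:R^-1 * \sum_(g < K.+1) avoid_lik K.+1 g th.
Proof.
move=> tS th; rewrite /empty_stat -mulrA mulr_suml; congr (_ * _).
apply: eq_bigr => g _; rewrite /lik -big_split/=; apply: eq_bigr => i _.
pose F (j : 'I_K.+1) := tau_of K.+1 t j * f (y i) (x j).
have F0 j : 0 <= F j by rewrite mulr_ge0// ltW// in_simplex_tau_gt0.
rewrite /zprob -/(F g) -[\sum_(j < _) _]/(\sum_j F j).
rewrite -[RHS]/(\sum_(j < K.+1 | j != g) F j).
(* Where the mixture density of an observation is zero, [zprob] is a division by zero. Both sides
   still agree: all terms of the vanishing sum are nonnegative, hence zero. *)
have [S0|S0] := eqVneq (\sum_j F j) 0; last first.
  by rewrite mulrBl mul1r divfK//
    [X in X - _](bigD1 g)//= addrAC subrr add0r.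
rewrite S0 mulr0 big1// => j _.
move/eqP : S0; rewrite psumr_eq0// => /allP/(_ j).
by rewrite mem_index_enum => /(_ isT)/eqP.
Qed.

Lemma prior_expect_empty_stat :
  E (fun th => (empty_stat y f K.+1 th * lik y f K.+1 th)%:E) =
  E (fun th => (avoid_lik K.+1 K th)%:E).
Proof.
(* The sums over components and over allocations become one sum over pairs, the form treated by
   [prior_expect_monomials]; afterwards they are separated again and exchangeability makes the terms
   for all [g] equal. *)
transitivity (E (fun th => (K.+1%:R^-1 * \sum_(p <-
    [seq p : 'I_K.+1 * {ffun 'I_n -> 'I_K.+1} <-
       index_enum ('I_K.+1 * {ffun 'I_n -> 'I_K.+1})%type |
     [forall i, val (p.2 i) != val p.1]]) mono p.2 th)%:E)).
  apply: eq_prior_expect => t x tS; rewrite empty_stat_lik//; congr (_ * _)%:E.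
  rewrite big_filter.
  rewrite (eq_bigr _ (fun (g : 'I_K.+1) _ =>
    avoid_lik_monomials K.+1 g (tau_of K.+1 t, x))).
  by rewrite pair_big_dep.
rewrite prior_expect_monomials//; last by move=> p j; exact: ltn_ord.
rewrite big_filter; have := pair_big_dep xpredT
  (fun (g : 'I_K.+1) (c : {ffun 'I_n -> 'I_K.+1}) => [forall i, val (c i) != val g])
  (fun _ c => prior_monomial (fun i => val (c i))).
rewrite /prior_monomial/= => <-.
under eq_bigr do rewrite -prior_expect_avoid_lik prior_expect_avoid_sym.
set X := E _.
transitivity (K.+1%:R^-1%:E * (\sum_(g < K.+1) 1%:E * X))%E.
  by congr (_ * _)%E; apply: eq_bigr => g _; rewrite mul1e.
rewrite -ge0_sume_distrl// sumEFin sumr_const card_ord muleA -EFinM.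
by rewrite mulVf ?mul1e// pnatr_eq0.
Qed.

End empty_component.

(** * Consistency of a quotient *)

Section consistency.
Context (R : realType) (d : measure_display) (Om : measurableType d).
Context (P : probability Om R).
Implicit Types X Y : nat -> Om -> R.

(** Writing the inverse as [f] times a power of [f ^+ 2] reduces it to the measurable [powR] at a
    nonnegative base; at a zero of [f] both forms give 0. *)
Lemma measurable_funV (f : Om -> R) :
  measurable_fun setT f -> measurable_fun setT (fun w => (f w)^-1).
Proof.
move=> mf.
rewrite (_ : (fun _ => _) = (fun w => f w * (f w ^+ 2) `^ (-1))); last first.
  apply/funext => w; rewrite powR_inv1 ?sqr_ge0//.
  have [->|f0] := eqVneq (f w) 0; first by rewrite invr0 mul0r.
  by rewrite expr2 invfM mulrA divff// mul1r.
apply: measurable_funM => //.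
apply: (measurableT_comp (measurable_powR _)).
exact: measurable_funX.
Qed.

Lemma measurable_deviation (f : Om -> R) (c eps : R) : measurable_fun setT f ->
  measurable [set w | eps <= `|f w - c|].
Proof.
move=> mf.
have mg : measurable_fun setT (fun w => `|f w - c|).
  by apply: measurableT_comp => //; exact: measurable_funB.
have -> : [set w | eps <= `|f w - c|] = (fun w => `|f w - c|) @^-1` `[eps, +oo[.
  by apply/seteqP; split => w /=; rewrite in_itv/= andbT.
by rewrite -[X in measurable X]setTI; apply: mg => //; exact: measurable_itv.
Qed.

(** Continuity of the ratio at [(a, b)] gives a [delta] such that a deviation of the ratio by [eps]
    forces [X] or [Y] to deviate by [delta]. A union bound then squeezes the probability to 0. *)
Lemma consistent_ratio X Y (k a b : R) : b != 0 ->
  consistent P X a -> consistent P Y b ->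
  consistent P (fun T w => k * X T w * (Y T w)^-1) (k * a * b^-1).
Proof.
move=> b0 [mX cX] [mY cY].
have mXY T : measurable_fun setT (fun w => k * X T w * (Y T w)^-1).
  by apply: measurable_funM; [exact: measurable_funM|exact: measurable_funV].
split=> // eps eps0.
have cvg_ratio : k * z.1 * z.2^-1 @[z --> (a, b)] --> k * a * b^-1.
  apply: cvgM; first by apply: cvgM; [exact: cvg_cst|exact: cvg_fst].
  by apply: cvgV => //; exact: cvg_snd.
have /nbhs_ballP[delta /= delta0 dP] :
    \forall z \near (a, b), `|k * a * b^-1 - k * z.1 * z.2^-1| < eps.
  by move/cvgrPdist_lt : cvg_ratio; apply.
pose D (Z : nat -> Om -> R) (c : R) (T : nat) : set Om :=
  [set w | delta <= `|Z T w - c|].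
have cD : (fun T => P (D X a T) + P (D Y b T))%E @ \oo --> 0%E.
  by rewrite -[X in _ --> X]adde0; apply: cvgeD => //; [exact: cX|exact: cY].
apply: (squeeze_cvge _ _ cD); last exact: cvg_cst.
apply: nearW => T; rewrite measure_ge0/=.
have mD Z c : (forall T, measurable_fun setT (Z T)) -> measurable (D Z c T).
  by move=> mZ; exact: measurable_deviation.
rewrite (le_trans _ (measureU2 _ _ _))//; [|exact: mD|exact: mD].
apply: le_measure; rewrite ?inE.
- exact: measurable_deviation.
- by apply: measurableU; exact: mD.
move=> w /= dev; have [Xa|Xa] := leP delta `|X T w - a|; first by left.
have [Yb|Yb] := leP delta `|Y T w - b|; first by right.
have : ball (a, b) delta (X T w, Y T w).
  by split; rewrite /ball/= distrC.
by move=> /dP/=; rewrite distrC ltNge dev.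
Qed.

End consistency.

(** * Estimator of the marginal likelihood *)

(** A positive factor preserves the infinities and [fine] sends them to 0, so infinite marginal
    likelihoods are covered too. *)
Lemma fine_gt0Ml (R : realType) (k : R) (x : \bar R) : 0 < k ->
  fine (k%:E * x)%E = k * fine x.
Proof.
move=> k0; case: x => [r//||] /=; first by rewrite gt0_muley ?lte_fin//= mulr0.
by rewrite gt0_muleNy ?lte_fin//= mulr0.
Qed.

Unset Implicit Arguments.

Theorem theorem5
  (R : realType) (d : measure_display) (Xi : measurableType d)
  (Y : Type) (n : nat) (y : 'I_n -> Y) (f : Y -> Xi -> R)
  (G : nat) (e : nat -> R) (pi : nat -> probability Xi R)
  (dO : measure_display) (Om : measurableType dO) (P : probability Om R)
  (Zprev_hat : nat -> Om -> R) (draws : nat -> Om -> @param R d Xi) :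
  (2 <= G)%N ->
  (forall yv th, 0 <= f yv th) ->
  (forall yv, measurable_fun setT (f yv)) ->
  (forall g, (g < G)%N -> 0 < e g) ->
  relabel_invariant e pi G ->
  consistent P Zprev_hat (fine (marg_lik y f e pi G.-1)) ->
  consistent P (fun T w => p0hat y f G (fun t => draws t w) T)
    (p0 y f e pi G) ->
  0 < p0 y f e pi G ->
  consistent P
    (fun T w =>
       (Gamma (\sum_(g < G) e g) * Gamma (n%:R + \sum_(g < G.-1) e g)
        / (Gamma (n%:R + \sum_(g < G) e g) * Gamma (\sum_(g < G.-1) e g)))
       * Zprev_hat T w * (p0hat y f G (fun t => draws t w) T)^-1)
    (fine (marg_lik y f e pi G))
  /\ p0 y f e pi G = post_prob_empty y f e pi G G.-1.
Proof.
case: G => [//|K]; rewrite ltnS => K0 f_ge0 mf e_gt0 exch cZ cp p0_gt0.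
pose k := Gamma (\sum_(g < K.+1) e g) * Gamma (n%:R + \sum_(g < K) e g) /
  (Gamma (n%:R + \sum_(g < K.+1) e g) * Gamma (\sum_(g < K) e g)).
have sum_gt0 (N : nat) : (0 < N <= K.+1)%N -> 0 < \sum_(g < N) e g.
  move=> /andP[N0 NK]; rewrite (bigD1 (Ordinal N0))//= ltr_wpDr//.
    by apply: sumr_ge0 => g _; rewrite ltW// e_gt0// (leq_trans (ltn_ord g)).
  by rewrite e_gt0.
have k_gt0 : 0 < k.
  have sK : 0 < \sum_(g < K) e g by rewrite sum_gt0// K0/=.
  have sK1 : 0 < \sum_(g < K.+1) e g by rewrite sum_gt0// ltn0Sn leqnn.
  by rewrite /k divr_gt0// mulr_gt0// Gamma_gt0// ltr_wpDl.
(* [A] is the common numerator of [p0] and of the posterior probability that the last component is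
   empty. *)
pose A : \bar R := prior_expect e pi K.+1 (fun th => (avoid_lik y f K.+1 K th)%:E).
have AE : fine A = k * fine (marg_lik y f e pi K).
  by rewrite /A prior_expect_avoid_last// fine_gt0Ml.
have p0E : p0 y f e pi K.+1 = fine A / fine (marg_lik y f e pi K.+1).
  by rewrite /p0 /post_expect prior_expect_empty_stat.
split; last first.
  rewrite p0E /post_prob_empty /A prior_expect_avoid_lik//; congr (fine _ / _).
  by apply: eq_bigr => c _; rewrite -prior_expect_monomial.
(* The target becomes the limit given by [consistent_ratio], by solving [p0E] for the marginal
   likelihood; positivity of [p0] excludes [fine A = 0]. *)
rewrite (_ : fine (marg_lik y f e pi K.+1) =
    k * fine (marg_lik y f e pi K) * (p0 y f e pi K.+1)^-1); last first.
  move: p0_gt0; rewrite p0E -AE => p0_gt0; rewrite invf_div mulrC divfK//.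
  by apply: contraTneq p0_gt0 => ->; rewrite mul0r ltxx.
apply: (@consistent_ratio _ _ _ _ _ _ k) => //.
by rewrite gt_eqF.
Qed.
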